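(* Let $n=3$ and let $G=K_{n,n}$ be the complete bipartite graph with vertex set $V=\{1,2\}\times[n]$ and an edge between $(1,i)$ and $(2,j)$ for all $i,j\in[n]$. Let $\pi=\mathrm{Unif}(V)$ and let $P$ be the lazy random walk on $G$, i.e. $P(x,x)=\frac12$, $P(x,y)=\frac1{2n}$ if $x,y$ are adjacent, and $P(x,y)=0$ otherwise. Then $$\eta_{\mathrm{KL}}(\pi,P)=\frac{\log n}{2\log(2n)},$$ and the supremum defining $\eta_{\mathrm{KL}}(\pi,P)$ is achieved at and only at point distributions: a probability distribution $\nu\neq\pi$ on $V$ satisfies $\frac{D(\nu P\|\pi)}{D(\nu\|\pi)}=\frac{\log n}{2\log(2n)}$ if and only if $\nu$ is a point mass at some $x\in V$.
   Context: For a finite set $\mathcal X$, a Markov kernel $P$ on $\mathcal X$ (row-stochastic matrix) with invariant distribution $\pi$, $$\eta_{\mathrm{KL}}(\pi,P)=\sup_{\nu:\,0<D(\nu\|\pi)<\infty}\frac{D(\nu P\|\pi P)}{D(\nu\|\pi)},$$ where $\nu$ ranges over probability distributions on $\mathcal X$, $(\nu P)(y)=\sum_x\nu(x)P(x,y)$, $\pi P=\pi$, and $D(\nu\|\pi)=\sum_x\nu(x)\log\frac{\nu(x)}{\pi(x)}$ is the KL divergence (natural logarithm, $0\log0=0$). Here $[n]=\{1,\dots,n\}$. *)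

(* Defs.v *)
From HB Require Import structures.
From mathcomp Require Import all_boot all_order all_algebra.
From mathcomp Require Import all_classical all_reals all_analysis.

Set Implicit Arguments.
Unset Strict Implicit.
Unset Printing Implicit Defensive.

Import Order.TTheory GRing.Theory Num.Theory.

Local Open Scope classical_set_scope.
Local Open Scope ring_scope.

Section KLContraction.
Variables (R : realType) (T : finType).
Implicit Types (mu nu pi : {ffun T -> R}) (P : T -> T -> R).

Definition is_dist nu : Prop := (forall x, 0 <= nu x) /\ \sum_x nu x = 1.

Definition is_markov_kernel P : Prop :=
  (forall x y, 0 <= P x y) /\ (forall x, \sum_y P x y = 1).

Definition push nu P : {ffun T -> R} := [ffun y => \sum_x nu x * P x y].

Definition uniform_dist : {ffun T -> R} := [ffun _ => #|T|%:R^-1].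

Definition point_mass (x : T) : {ffun T -> R} := [ffun y => (y == x)%:R].

(* a * log (a / b) for a, b >= 0, with 0 log 0 = 0 and a log (a / 0) = +oo for
   a > 0, so that KL nu pi is finite iff nu is absolutely continuous wrt pi. *)
Definition KL_term (a b : R) : \bar R :=
  if a == 0 then 0%E else if b == 0 then +oo%E else (a * ln (a / b))%:E.

Definition KL nu pi : \bar R := (\sum_x KL_term (nu x) (pi x))%E.

Definition eta_KL pi P : \bar R :=
  ereal_sup [set (KL (push nu P) (push pi P) / KL nu pi)%E | nu in
    [set nu | is_dist nu /\ (0 < KL nu pi)%E /\ (KL nu pi < +oo)%E]].

End KLContraction.

Arguments uniform_dist {R} T.
Arguments point_mass {R T} x.

(* Vertices {1,2} x [n], indexed from 0. *)
Definition Knn_vertex (n : nat) : finType := ('I_2 * 'I_n)%type.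

Definition Knn_adj (n : nat) : rel (Knn_vertex n) := fun x y => x.1 != y.1.

Definition lazy_walk (R : realType) (n : nat) (x y : Knn_vertex n) : R :=
  if x == y then 2^-1
  else if Knn_adj x y then (2 * n%:R)^-1
  else 0.

Section KnnWalk.
Variables (R : realType) (n : nat).
Hypothesis n_gt0 : (0 < n)%N.

Lemma uniform_Knn_dist : is_dist (uniform_dist (Knn_vertex n) : {ffun _ -> R}).
Proof.
split=> [x|]; first by rewrite ffunE invr_ge0.
under eq_bigr do rewrite ffunE.
rewrite sumr_const -[X in X *+ _]mul1r -mulrnAr -mulr_natl mul1r divff//.
by rewrite pnatr_eq0 card_prod !card_ord -lt0n muln_gt0.
Qed.

Lemma lazy_walk_sym (x y : Knn_vertex n) :
  lazy_walk R x y = lazy_walk R y x.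
Proof. by rewrite /lazy_walk /Knn_adj eq_sym [x.1 == _]eq_sym. Qed.

Lemma lazy_walk_markov : is_markov_kernel (@lazy_walk R n).
Proof.
split=> [x y|x].
  by rewrite /lazy_walk; do 2?case: ifP => _; rewrite // invr_ge0// mulr_ge0.
rewrite (bigD1 x)//= {1}/lazy_walk eqxx.
rewrite (bigID (fun y => Knn_adj x y))/= [X in _ + (_ + X)]big1 ?addr0; last first.
  by move=> y /andP[yx /negPf adj]; rewrite /lazy_walk eq_sym (negPf yx) adj.
rewrite (eq_bigr (fun _ => (2 * n%:R)^-1)); last first.
  by move=> y /andP[yx adj]; rewrite /lazy_walk eq_sym (negPf yx) adj.
rewrite (eq_bigl (fun y : Knn_vertex n => (y.1 != x.1) && true)); last first.
  move=> y; rewrite andbT /Knn_adj eq_sym; case: eqVneq => [->|]; rewrite ?eqxx//.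
  by rewrite [_.1 == _]eq_sym.
rewrite -(pair_big (fun i => i != x.1) xpredT (fun _ _ => (2 * n%:R : R)^-1))/=.
rewrite sumr_const sumr_const cardC1 !card_ord/= mulr1n -[_^-1 *+ n]mulr_natr invfM -mulrA mulVf.
  by rewrite mulr1 -[X in X + X]mul1r -mulrDl divff// pnatr_eq0.
by rewrite pnatr_eq0 -lt0n.
Qed.

Lemma uniform_Knn_invariant :
  push (uniform_dist (Knn_vertex n)) (@lazy_walk R n)
  = uniform_dist (Knn_vertex n).
Proof.
apply/ffunP => y; rewrite !ffunE.
under eq_bigr do rewrite ffunE lazy_walk_sym.
by rewrite -mulr_sumr (proj2 lazy_walk_markov) mulr1.
Qed.

End KnnWalk.

(* Main.v *)
Require Import Defs.
From HB Require Import structures.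
From mathcomp Require Import all_boot all_order all_algebra.
From mathcomp Require Import all_classical all_reals all_analysis.
From mathcomp Require Import ring lra.
Import Order.TTheory GRing.Theory Num.Theory.
Local Open Scope ring_scope.

(* Let a and b <= 1/2 be the masses that nu gives to the two sides, and let
   x i, y j be 3 times its values there. With f t = t ln t the claim reads
     ln 6 (sum f(x i + b) + sum f(y j + a))
       <= ln 3 (3 ln 2 + sum f(x i) + sum f(y j)),
   and for fixed b both sides are sums over single coordinates, so it suffices
   to find, on each side, an affine function of the coordinate that separates
   the two summands and whose values add up to the right constant.
   On the light side convexity of f reduces this to b = 1/2, where the
   one-variable function [slack] must be nonnegative on [0, 3]. On the heavy
   side the slope [heavy_slope] makes the gap at x = k b equal to
   b (slack k + k m) with m = [heavy_excess b] >= 0, so only k > 3 remains;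
   there the gap is concave in k, and at the largest value k = 3 a / b it is
   [edge_slack k], which is positive on [3, +oo[. For b = 0 the inequality is
   f x <= x ln 3 on [0, 3]. *)

Set Implicit Arguments.
Unset Strict Implicit.
Unset Printing Implicit Defensive.

(** * Consequences of the mean value theorem, and derivative rules *)

Section Calculus.
Context {R : realType}.
Implicit Types (f g df : R -> R) (a b c d x : R).

Lemma segment_MVT f df a b : a < b ->
  (forall x, a <= x <= b -> is_derive x 1 f (df x)) ->
  exists2 c, a < c < b & f b - f a = df c * (b - a).
Proof.
move=> ab dfE; have [||c] := @MVT R f df a b ab.
- by move=> x; rewrite in_itv/= => /andP[/ltW ? /ltW ?]; apply: dfE; apply/andP.
- apply: derivable_within_continuous => x; rewrite in_itv/= => xab.
  by case: (dfE x xab).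
- by rewrite in_itv/= => cab ->; exists c.
Qed.

Lemma convex_tangent f df a b c x :
  (forall x, a <= x <= b -> is_derive x 1 f (df x)) ->
  (forall x y, a <= x -> x < y -> y <= b -> df x <= df y) ->
  a <= c <= b -> a <= x <= b -> f c + df c * (x - c) <= f x.
Proof.
move=> dfE df_ndecr /andP[ac cb] /andP[ax xb].
have [cx|xc|->] := ltgtP c x; last by lra.
  have [|t /andP[ct tx] fE] := @segment_MVT f df c x cx.
    by move=> u /andP[cu ux]; apply: dfE; rewrite (le_trans ac)//= (le_trans ux).
  by have := df_ndecr c t ac ct (le_trans (ltW tx) xb); nra.
have [|t /andP[xt tc] fE] := @segment_MVT f df x c xc.
  by move=> u /andP[xu uc]; apply: dfE; rewrite (le_trans ax)//= (le_trans uc).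
by have := df_ndecr t c (le_trans ax (ltW xt)) tc cb; nra.
Qed.

(** A nonpositive interior value would force, by the mean value theorem, a negative slope before it
    and a positive one after it, against the monotonicity of [df]. *)
Lemma concave_gt0 f df a b x :
  (forall x, a <= x <= b -> is_derive x 1 f (df x)) ->
  (forall x y, a <= x -> x < y -> y <= b -> df y <= df x) ->
  0 < f a -> 0 < f b -> a <= x <= b -> 0 < f x.
Proof.
move=> dfE df_nincr fa fb /andP[]; rewrite le_eqVlt => /predU1P[<-//|ax].
rewrite le_eqVlt => /predU1P[->//|xb]; rewrite ltNge; apply/negP => fx.
have [|s /andP[s_gt s_lt] fs] := @segment_MVT f df a x ax.
  by move=> u /andP[? ?]; apply: dfE; lra.
have [|t /andP[t_gt t_lt] ft] := @segment_MVT f df x b xb.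
  by move=> u /andP[? ?]; apply: dfE; lra.
have : df s < 0 by nra.
have : 0 < df t by nra.
by have := df_nincr s t ltac:(lra) ltac:(lra) ltac:(lra); lra.
Qed.

Lemma is_derive_congr f g x d d' :
  is_derive x 1 f d -> f =1 g -> d = d' -> is_derive x 1 g d'.
Proof. by move=> fd /funext <- <-. Qed.

Lemma is_derive_ln_shift c x : 0 < c + x ->
  is_derive x 1 (fun t => ln (c + t)) (c + x)^-1.
Proof.
move=> cx0; have dln := is_derive1_ln cx0.
have dsh : is_derive x 1 (fun t => c + t) 1.
  have := is_deriveD (is_derive_cst c x 1) (is_derive_id x (1 : R)).
  by rewrite add0r.
by have := is_derive1_comp dln dsh; rewrite mulr1.
Qed.

Lemma is_derive_xlnx_shift c x : 0 < c + x ->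
  is_derive x 1 (fun t => (c + t) * ln (c + t)) (ln (c + x) + 1).
Proof.
move=> cx0; have dsh : is_derive x 1 (fun t => c + t) 1.
  have := is_deriveD (is_derive_cst c x 1) (is_derive_id x (1 : R)).
  by rewrite add0r.
have := is_deriveM dsh (is_derive_ln_shift cx0); rewrite /GRing.scale/=.
by rewrite mulr1 mulfV ?gt_eqF// addrC.
Qed.

End Calculus.

(** * Rational bounds on logarithms *)

Section LogBounds.
Context {R : realType}.
Implicit Types a b c x y : R.

Lemma is_derive_atanh_poly c x : -1 < x < 1 ->
  is_derive x 1 (fun t => ln (1 + t) - ln (1 - t) - (2 * t + c * t ^+ 3))
    (2 / (1 - x ^+ 2) - (2 + 3 * c * x ^+ 2)).
Proof.
move=> /andP[x1 x2].
have x1' : 0 < 1 + x by lra.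
have x2' : 0 < 1 - x by lra.
have dsh : is_derive x 1 (fun t => 1 - t) (-1).
  have := is_deriveB (is_derive_cst (1 : R) x 1) (is_derive_id x (1 : R)).
  by rewrite sub0r.
have dln := @is_derive1_comp R (@ln R) (fun t => 1 - t) x _ _ (is_derive1_ln x2') dsh.
have d3 := is_deriveM (is_derive_id x (1 : R))
  (is_deriveM (is_derive_id x (1 : R)) (is_derive_id x (1 : R))).
have h := is_deriveB (is_deriveB (is_derive_ln_shift x1') dln)
  (is_deriveD (is_deriveZ 2 (is_derive_id x (1 : R))) (is_deriveZ c d3)).
apply: (is_derive_eq h); rewrite /GRing.scale/= !fctE; field.
by apply/and3P; split; apply/lt0r_neq0; nra.
Qed.

(** The middle term is 2 artanh x, with cubic Taylor coefficient [2 / 3]. The larger [7 / 10]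
    absorbs the tail: the derivative of the difference is nonpositive while [x ^+ 2 <= 1 / 21]. *)
Lemma atanh_bounds x : 0 <= x <= 1 / 5 ->
  2 * x + 2 / 3 * x ^+ 3 <= ln (1 + x) - ln (1 - x) <= 2 * x + 7 / 10 * x ^+ 3.
Proof.
move=> /andP[]; rewrite le_eqVlt => /predU1P[<- _|x0 x5].
  by rewrite addr0 subr0 subrr expr0n/= !mulr0 addr0 lexx.
have der c u : 0 <= u <= x ->
    is_derive u 1 (fun t => ln (1 + t) - ln (1 - t) - (2 * t + c * t ^+ 3))
    (2 / (1 - u ^+ 2) - (2 + 3 * c * u ^+ 2)).
  by move=> ?; apply: is_derive_atanh_poly; lra.
have [u /andP[u0 ux]] := segment_MVT x0 (der (2 / 3)).
have [v /andP[v0 vx]] := segment_MVT x0 (der (7 / 10)).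
rewrite !addr0 !subr0 !mulr0 expr0n/= mulr0 addr0 ln1 !subr0 => Hv Hu.
have sq_small w : 0 < w -> w < x -> 0 < w ^+ 2 <= 1 / 25.
  by move=> w0 wx; rewrite exprn_gt0//= expr2; nra.
have ge0 : 0 <= 2 / (1 - u ^+ 2) - (2 + 3 * (2 / 3) * u ^+ 2).
  move: (u ^+ 2) (sq_small _ u0 ux) => w ?.
  by rewrite subr_ge0 ler_pdivlMr; nra.
have le0 : 2 / (1 - v ^+ 2) - (2 + 3 * (7 / 10) * v ^+ 2) <= 0.
  move: (v ^+ 2) (sq_small _ v0 vx) => w ?.
  by rewrite subr_le0 ler_pdivrMr; nra.
move: ge0 le0 Hu Hv; set p := _ - (2 + _); set q := _ - (2 + _) => ge0 le0 Hu Hv.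
by apply/andP; split; nra.
Qed.

(** Here [y = (a - b) / (a + b)], so [a / b = (1 + y) / (1 - y)]; close [a] and [b] give sharp
    bounds. *)
Lemma lnB_bounds a b y : 0 < b -> a * (1 - y) = b * (1 + y) -> 0 <= y <= 1 / 5 ->
  2 * y + 2 / 3 * y ^+ 3 <= ln a - ln b <= 2 * y + 7 / 10 * y ^+ 3.
Proof.
move=> b0 ab y05; suff -> : ln a - ln b = ln (1 + y) - ln (1 - y).
  exact: atanh_bounds.
have a0 : 0 < a by nra.
by have := congr1 (@ln R) ab; rewrite !lnM ?posrE//; lra.
Qed.

Lemma ln2_ln3_ln5_bounds :
  [/\ 131 / 189 <= (ln 2 : R) <= 61 / 88,
      78 / 71 <= (ln 3 : R) <= 323 / 294 &
      478 / 297 <= (ln 5 : R) <= 272 / 169].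
Proof.
(* 16/15, 25/24 and 81/80 generate multiplicatively 2, 3 and 5. *)
have h1 := @lnB_bounds 16 15 (1 / 31) ltac:(lra) ltac:(lra) ltac:(lra).
have h2 := @lnB_bounds 25 24 (1 / 49) ltac:(lra) ltac:(lra) ltac:(lra).
have h3 := @lnB_bounds 81 80 (1 / 161) ltac:(lra) ltac:(lra) ltac:(lra).
have e16 : ln 16 = 4 * ln 2 :> R.
  by rewrite (_ : 16 = 2 ^+ 4) ?lnXn ?mulr_natl//; lra.
have e15 : ln 15 = ln 3 + ln 5 :> R.
  by rewrite (_ : 15 = 3 * 5) ?lnM ?posrE//; lra.
have e25 : ln 25 = 2 * ln 5 :> R.
  by rewrite (_ : 25 = 5 ^+ 2) ?lnXn ?mulr_natl//; lra.
have e24 : ln 24 = 3 * ln 2 + ln 3 :> R.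
  by rewrite (_ : 24 = 2 ^+ 3 * 3) ?lnM ?posrE ?lnXn ?mulr_natl//; lra.
have e81 : ln 81 = 4 * ln 3 :> R.
  by rewrite (_ : 81 = 3 ^+ 4) ?lnXn ?mulr_natl//; lra.
have e80 : ln 80 = 4 * ln 2 + ln 5 :> R.
  by rewrite (_ : 80 = 2 ^+ 4 * 5) ?lnM ?posrE ?lnXn ?mulr_natl//; lra.
rewrite e16 e15 in h1; rewrite e25 e24 in h2; rewrite e81 e80 in h3.
by split; lra.
Qed.

End LogBounds.

(** * Positivity of the one-variable functions *)

Section Slack.
Context {R : realType}.
Implicit Types a b k m u v x y z : R.
Local Notation l2 := (ln 2 : R).
Local Notation l3 := (ln 3 : R).

(** This is [2 * light_gap (1 / 2) (z / 2)]: [z] is a light coordinate in units of its average. *)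
Definition slack z : R :=
  l3 * (z * ln z) + l2 * (z - 1) - (l2 + l3) * ((1 + z) * (ln (1 + z) - l2)).

Definition dslack z : R := l3 * ln z - (l2 + l3) * (ln (1 + z) - l2).

Lemma is_derive_slack z : 0 < z -> is_derive z 1 slack (dslack z).
Proof.
move=> z0; have z1 : 0 < 1 + z by lra.
have did := is_derive_id z (1 : R).
have d1 := is_deriveD (is_derive_cst (1 : R) z 1) did.
have d0 := is_deriveM did (is_derive1_ln z0).
have h := is_deriveB (is_deriveD (is_deriveZ l3 d0)
  (is_deriveZ l2 (is_deriveB did (is_derive_cst (1 : R) z 1))))
  (is_deriveZ (l2 + l3) (is_deriveB (is_derive_xlnx_shift z1)
    (is_deriveZ l2 d1))).
apply: (is_derive_congr h) => [t|].
  by rewrite /slack !fctE/= /GRing.scale/=; ring.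
by rewrite /GRing.scale/= /dslack; field; exact/lt0r_neq0.
Qed.

Lemma is_derive_dslack z : 0 < z ->
  is_derive z 1 dslack ((l3 - z * l2) / (z * (1 + z))).
Proof.
move=> z0; have z1 : 0 < 1 + z by lra.
have h := is_deriveB (is_deriveZ l3 (is_derive1_ln z0))
  (is_deriveZ (l2 + l3) (is_deriveB (is_derive_ln_shift z1)
    (is_derive_cst l2 z 1))).
apply: (is_derive_congr h) => [t|].
  by rewrite /dslack !fctE/= /GRing.scale/=; ring.
by rewrite /GRing.scale/=; field; apply/andP; split; exact/lt0r_neq0.
Qed.

(** For [z > 0] the second derivative of [slack] has the sign of [l3 - z * l2]. *)
Lemma dslack_incr u v : 0 < u -> u < v -> v * l2 <= l3 -> dslack u < dslack v.
Proof.
move=> u0 uv v3; have [|t /andP[ut tv] E] := @segment_MVT R dslack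
  (fun z => (l3 - z * l2) / (z * (1 + z))) u v uv.
  by move=> ? ?; apply: is_derive_dslack; lra.
have l20 : 0 < l2 by rewrite ln_gt0//; lra.
rewrite -subr_gt0 E mulr_gt0 ?subr_gt0// divr_gt0 ?mulr_gt0//; nra.
Qed.

Lemma dslack_decr u v : 0 < u -> u < v -> l3 <= u * l2 -> dslack v < dslack u.
Proof.
move=> u0 uv v3; have [|t /andP[ut tv] E] := @segment_MVT R dslack
  (fun z => (l3 - z * l2) / (z * (1 + z))) u v uv.
  by move=> ? ?; apply: is_derive_dslack; lra.
have l20 : 0 < l2 by rewrite ln_gt0//; lra.
rewrite -subr_lt0 E pmulr_llt0 ?subr_gt0// pmulr_llt0 ?invr_gt0 ?mulr_gt0//; nra.
Qed.

Lemma slack1 : slack 1 = 0.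
Proof. by rewrite /slack ln1 -[1 + 1]/2; ring. Qed.

Lemma dslack1 : dslack 1 = 0.
Proof. by rewrite /dslack ln1 -[1 + 1]/2; ring. Qed.

Lemma ln4 : ln 4 = 2 * l2 :> R.
Proof. by rewrite (_ : 4 = 2 ^+ 2) ?lnXn ?mulr_natl//; lra. Qed.

(** Since 1 + 3 is a power of 2, the value is a polynomial in [l2] and [l3]; it is only about
    0.04. *)
Lemma slack3_gt0 : 0 < slack 3.
Proof.
rewrite /slack -[1 + 3]/4 ln4.
have [] := @ln2_ln3_ln5_bounds R; nra.
Qed.

(** Both [slack] and [dslack] vanish at 1, and [slack] is convex up to [l3 / l2 > 1]; beyond that it
    is concave with positive values at [l3 / l2] and 3. *)
Lemma slack_gt0 z : 0 <= z <= 3 -> z != 1 -> 0 < slack z.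
Proof.
have [b2 b3 _] := @ln2_ln3_ln5_bounds R.
have l20 : 0 < l2 by lra.
move=> /andP[]; rewrite le_eqVlt => /predU1P[<- _ _|z0 z3 z1].
  (* [slack 0 = l2 * (l2 + l3 - 1)], and ln 6 > 1. *)
  by rewrite /slack mul0r mulr0 addr0 ln1; nra.
have := slack1; have := dslack1 => d1 s1.
have gt_1_k w : 1 < w -> w * l2 <= l3 -> 0 < slack w.
  move=> w1 wk; have [|t /andP[? tw]] := @segment_MVT R slack dslack 1 w w1.
    by move=> ? ?; apply: is_derive_slack; lra.
  have : 0 < dslack t by rewrite -d1 dslack_incr//; nra.
  by rewrite s1 subr0 => ? ->; rewrite mulr_gt0// subr_gt0.
case: (ltgtP z 1) z1 => // z1 _.
  have [|t /andP[? ?]] := @segment_MVT R slack dslack z 1 z1.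
    by move=> ? ?; apply: is_derive_slack; lra.
  have : dslack t < 0 by rewrite -d1 dslack_incr//; lra.
  by rewrite s1; nra.
have [?|zk] := leP (z * l2) l3; first exact: gt_1_k.
(* The inflection point of [slack]. *)
pose k := l3 / l2; have kE : k * l2 = l3 by rewrite divfK// gt_eqF.
have k1 : 1 < k by nra.
apply: (@concave_gt0 R slack dslack k 3).
- by move=> ? ?; apply: is_derive_slack; lra.
- by move=> u v ku uv _; apply/ltW/dslack_decr => //; nra.
- by apply: gt_1_k; lra.
- exact: slack3_gt0.
- by nra.
Qed.

(** Obtained from [slack k + k * heavy_excess b] by eliminating [b = 3 / (3 + k)], the case where a
    single vertex carries all the heavy mass. *)
Definition edge_slack k : R :=
  l3 * (k * ln k) + 2 * l2 - (l2 + l3) * ((1 + k) * (ln (1 + k) - l2))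
  + l2 * ((3 + k) * (ln (3 + k) - (l2 + l3))).

Definition dedge_slack k : R :=
  l2 * (ln (3 + k) - ln (1 + k)) - l3 * (ln (1 + k) - ln k).

Lemma is_derive_edge_slack k : 0 < k ->
  is_derive k 1 edge_slack (dedge_slack k).
Proof.
move=> k0; have k3 : 0 < 3 + k by lra.
have did := is_derive_id k (1 : R).
have h := is_deriveD (is_derive_slack k0) (is_deriveD
  (is_deriveZ l2 (is_derive_xlnx_shift k3))
  (is_deriveB (is_derive_cst (3 * l2 - 3 * l2 * (l2 + l3)) k 1)
    (is_deriveZ (l2 + l2 * (l2 + l3)) did))).
apply: (is_derive_congr h) => [t|].
  by rewrite /edge_slack /slack !fctE/= /GRing.scale/=; ring.
by rewrite /GRing.scale/= /dslack /dedge_slack; ring.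
Qed.

Lemma is_derive_dedge_slack k : 0 < k -> is_derive k 1 dedge_slack
  ((3 * l3 - k * (2 * l2 - l3)) / (k * (1 + k) * (3 + k))).
Proof.
move=> k0; have k1 : 0 < 1 + k by lra.
have k3 : 0 < 3 + k by lra.
have h := is_deriveB (is_deriveZ l2 (is_deriveB (is_derive_ln_shift k3)
    (is_derive_ln_shift k1)))
  (is_deriveZ l3 (is_deriveB (is_derive_ln_shift k1) (is_derive1_ln k0))).
apply: (is_derive_congr h) => [t|].
  by rewrite /dedge_slack !fctE/= /GRing.scale/=; ring.
by rewrite /GRing.scale/=; field; apply/and3P; split; exact/lt0r_neq0.
Qed.

(** The log differences are about [2 * y] and [2 * w], and [y / w >= 13 / 8 > l3 / l2], where
    [13 / 8] is the ratio at [k = 6]. *)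
Lemma dedge_slack_ge0 k : 6 <= k -> 0 <= dedge_slack k.
Proof.
move=> k6; have [b2 b3 _] := @ln2_ln3_ln5_bounds R.
pose y := (k + 2)^-1; pose w := (2 * k + 1)^-1.
have yE : (k + 2) * y = 1 by rewrite mulfV// lt0r_neq0//; lra.
have wE : (2 * k + 1) * w = 1 by rewrite mulfV// lt0r_neq0//; lra.
have y0 : 0 < y by rewrite invr_gt0; lra.
have w0 : 0 < w by rewrite invr_gt0; lra.
have w13 : w <= 1 / 13 by nra.
have yw : 13 / 8 * w <= y by nra.
have /andP[ge_y _] := @lnB_bounds R (3 + k) (1 + k) y ltac:(lra) ltac:(nra) ltac:(nra).
have /andP[_ le_w] := @lnB_bounds R (1 + k) k w ltac:(lra) ltac:(nra) ltac:(nra).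
have y3 : 0 <= y ^+ 3 by rewrite exprn_ge0// ltW.
have w3 : w ^+ 3 <= 1 / 169 * w by rewrite exprS [leRHS]mulrC ler_wpM2l ?(ltW w0)// expr2; nra.
by rewrite /dedge_slack; nra.
Qed.

(** The minimum of [edge_slack] on [3, 6] lies close to 5, where only logarithms of 5, 6 and 8
    occur. *)
Lemma edge_slack5_bounds :
  1 / 500 < edge_slack 5 /\ - (1 / 500) <= dedge_slack 5 <= 0.
Proof.
have [b2 b3 b5] := @ln2_ln3_ln5_bounds R.
have e6 : ln (1 + 5) = l2 + l3 by rewrite -lnM ?posrE//; congr ln; lra.
have e8 : ln (3 + 5) = 3 * l2.
  by rewrite (_ : 3 + 5 = 2 ^+ 3) ?lnXn ?mulr_natl//; lra.
by rewrite /edge_slack /dedge_slack e6 e8; split; nra.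
Qed.

(** On [3, 6] the function is convex and lies above its tangent at 5; from 6 on it is
    nondecreasing. *)
Lemma edge_slack_gt0 k : 3 <= k -> 0 < edge_slack k.
Proof.
have [b2 b3 _] := @ln2_ln3_ln5_bounds R.
have le6 x : 3 <= x <= 6 -> 0 < edge_slack x.
  move=> x36; have [e5 d5] := edge_slack5_bounds.
  (* The slope lies in [-1/500, 0] and [x - 5 <= 1], so the tangent loses at most 1/500. *)
  suff : edge_slack 5 + dedge_slack 5 * (x - 5) <= edge_slack x by nra.
  apply: (@convex_tangent R _ _ 3 6) => //; last by lra.
    by move=> u ?; apply: is_derive_edge_slack; lra.
  move=> u v u3 uv v6; have [|t ? E] := @segment_MVT R dedge_slack
      (fun k => (3 * l3 - k * (2 * l2 - l3)) / (k * (1 + k) * (3 + k))) u v uv.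
    by move=> ? ?; apply: is_derive_dedge_slack; lra.
  rewrite -subr_ge0 E mulr_ge0//; last by lra.
  by rewrite divr_ge0//; [nra|rewrite !mulr_ge0//; lra].
move=> k3; have [k6|k6] := leP k 6; first by apply: le6; lra.
have [|t ? E] := @segment_MVT R edge_slack dedge_slack 6 k k6.
  by move=> ? ?; apply: is_derive_edge_slack; lra.
by have := @dedge_slack_ge0 t ltac:(lra); have := le6 6 ltac:(lra); nra.
Qed.

End Slack.

(** * Supporting-line inequalities for single coordinates *)

Section Gaps.
Context {R : realType}.
Implicit Types b k m t v w x y z : R.
Local Notation l2 := (ln 2 : R).
Local Notation l3 := (ln 3 : R).

Lemma ln_le_subr1 x : 0 < x -> ln x <= x - 1.
Proof. by move=> x0; have := @le_ln1Dx R (x - 1); rewrite subrKC; apply; lra. Qed.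

Lemma ln_lt_subr1 x : 0 < x -> x != 1 -> ln x < x - 1.
Proof.
move=> x0 x1; have /expR_gt1Dx : ln x != 0 by rewrite ln_eq0.
by rewrite lnK ?posrE//; lra.
Qed.

(** Convexity of v ln v between 1, where it vanishes, and [w]; it follows from ln u <= u - 1 at
    [v / w] and at [v]. *)
Lemma xlnx_convex1 t w : 0 <= t <= 1 -> 0 < w ->
  (1 + t * (w - 1)) * ln (1 + t * (w - 1)) <= t * (w * ln w).
Proof.
move=> t01 w0; set v := 1 + _; have v0 : 0 < v by rewrite /v; nra.
have h1 := ln_le_subr1 (divr_gt0 v0 w0).
have h2 := ln_le_subr1 v0.
rewrite ln_div ?posrE// in h1.
have h3 : w * (ln v - ln w) <= v - w.
  by rewrite (le_trans (ler_wpM2l (ltW w0) h1))// mulrBr mulr1 mulrC divfK ?gt_eqF.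
have vE : v = t * w + (1 - t) by rewrite /v; ring.
rewrite -subr_ge0 (_ : _ - _ =
  - (t * (w * (ln v - ln w))) - (1 - t) * ln v); last by rewrite {1}vE; ring.
by nra.
Qed.

(* The gap in the supporting-line inequality for the side of mass b <= 1/2;
   the line vanishes at y = b, the average of the rescaled masses. *)
Definition light_gap b y : R := l3 * (y * ln y - y * ln b) + l2 * (y - b)
  - (l2 + l3) * ((y + (1 - b)) * ln (y + (1 - b))).

Lemma light_gap_ge_slack b y : 0 < b <= 1 / 2 -> 0 <= y ->
  b * slack (y / b) <= light_gap b y.
Proof.
move=> /andP[b0 b2] y0; set z := y / b.
have yE : y = b * z by rewrite mulrC divfK// gt_eqF.
have z0 : 0 <= z by rewrite divr_ge0// ltW.
clearbody z; subst y.
have ylny : b * z * ln (b * z) - b * z * ln b = b * (z * ln z).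
  have [z_0|zn0] := eqVneq z 0; first by rewrite z_0 !(mulr0, mul0r) subrr.
  have z_gt0 : 0 < z by rewrite lt0r zn0.
  by rewrite lnM ?posrE//; ring.
(* [b * z + (1 - b)] is the mean of 1 and [(1 + z) / 2] with weights [1 - 2 * b] and [2 * b]; this
   is where [b <= 1 / 2] enters. *)
have := @xlnx_convex1 (2 * b) ((1 + z) / 2) ltac:(lra) ltac:(lra).
rewrite (_ : 1 + _ * _ = b * z + (1 - b)); last by lra.
rewrite (@ln_div R (1 + z) 2) ?posrE; [|lra|lra].
move=> le_f; rewrite /light_gap ylny /slack in le_f *.
have l60 : 0 < l2 + l3 by rewrite addr_gt0// ln_gt0//; lra.
have := ler_wpM2l (ltW l60) le_f; nra.
Qed.

Lemma light_gap_gt0 b y : 0 < b <= 1 / 2 -> 0 <= y <= 3 * b -> y != b ->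
  0 < light_gap b y.
Proof.
move=> bP yP yb; have /andP[b0 _] := bP.
apply: lt_le_trans (light_gap_ge_slack bP _); last by lra.
rewrite mulr_gt0// slack_gt0//.
  by rewrite divr_ge0/= ?ler_pdivrMr//; lra.
by apply: contra yb => /eqP yb1; rewrite -(divfK (lt0r_neq0 b0) y) yb1 mul1r.
Qed.

Lemma light_gap_ge0 b y : 0 < b <= 1 / 2 -> 0 <= y <= 3 * b ->
  0 <= light_gap b y.
Proof.
move=> bP yP; have [->|yb] := eqVneq y b; last exact/ltW/light_gap_gt0.
apply: le_trans (light_gap_ge_slack bP _); last by lra.
by rewrite divff ?slack1 ?mulr0//; apply/lt0r_neq0; lra.
Qed.

(* The slope of the supporting line on the heavy side, chosen so that the gap
   on the ray x = k b splits as b (slack k + k m) with m depending on b only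
   (see heavy_gapE). *)
Definition heavy_slope b : R := l2 * (l3 + b / (1 - b) * (1 - ln (2 * b))).

(** The constant [b * ln b] returns, over three coordinates, what the terms [y * ln b] take from the
    light gaps. *)
Definition heavy_gap b x : R :=
  l3 * (l2 + b * ln b + x * ln x) + heavy_slope b * (x - (1 - b))
  - (l2 + l3) * ((x + b) * ln (x + b)).

Definition heavy_excess b : R :=
  l2 * (b / (1 - b) * (1 - ln (2 * b)) - ln (2 * b) - 1).

Lemma heavy_gapE b x : 0 < b <= 1 / 2 -> 0 <= x ->
  heavy_gap b x = b * (slack (x / b) + x / b * heavy_excess b).
Proof.
move=> /andP[b0 b2] x0; set k := x / b.
have xE : x = b * k by rewrite mulrC divfK// gt_eqF.
have k0 : 0 <= k by rewrite divr_ge0// ltW.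
clearbody k; subst x.
have xlnx : b * k * ln (b * k) = b * (k * (ln b + ln k)).
  have [k_0|kn0] := eqVneq k 0; first by rewrite k_0 !(mulr0, mul0r).
  have k_gt0 : 0 < k by rewrite lt0r kn0.
  by rewrite lnM ?posrE//; ring.
have xblnxb : (b * k + b) * ln (b * k + b) = b * (1 + k) * (ln b + ln (1 + k)).
  by rewrite -lnM ?posrE//; [congr (_ * ln _); ring|lra].
rewrite /heavy_gap xlnx xblnxb /heavy_slope /heavy_excess /slack.
by rewrite lnM ?posrE//; field; apply/lt0r_neq0; lra.
Qed.

Lemma heavy_excess_half : heavy_excess (1 / 2) = 0.
Proof.
rewrite /heavy_excess (_ : 2 * (1 / 2) = 1) ?ln1; last by lra.
by rewrite (_ : 1 - 1 / 2 = 1 / 2) ?divff//; lra.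
Qed.

(** The excess equals [l2 * (2 * b - 1 - ln (2 * b)) / (1 - b)]. *)
Lemma heavy_excess_gt0 b : 0 < b < 1 / 2 -> 0 < heavy_excess b.
Proof.
move=> bP; have l20 : 0 < l2 by rewrite ln_gt0//; lra.
have := @ln_lt_subr1 (2 * b) ltac:(lra) ltac:(apply/eqP; lra).
rewrite /heavy_excess; move: (ln (2 * b)) => t t_lt; rewrite mulr_gt0//.
have q0 : 0 < b / (1 - b) by rewrite divr_gt0//; lra.
have : b / (1 - b) * (1 - b) = b by rewrite divfK//; apply/eqP; lra.
by move: q0; set q := b / _; nra.
Qed.

Lemma heavy_excess_ge0 b : 0 < b <= 1 / 2 -> 0 <= heavy_excess b.
Proof.
move=> /andP[b0]; rewrite le_eqVlt => /predU1P[->|b2].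
  by rewrite heavy_excess_half.
by rewrite ltW// heavy_excess_gt0// b0.
Qed.

Lemma edge_slackE b (k := 3 * (1 - b) / b) : 0 < b <= 1 / 2 ->
  slack k + k * heavy_excess b = edge_slack k.
Proof.
move=> bP; have b0 : 0 < b by lra.
have k3 : 3 + k = 3 / b by rewrite /k; field; exact/lt0r_neq0.
have lnk3 : ln (3 + k) = l3 - ln b by rewrite k3 ln_div ?posrE.
have ln2b : ln (2 * b) = l2 + ln b by rewrite lnM ?posrE.
rewrite /slack /edge_slack /heavy_excess lnk3 ln2b.
move: (ln k) (ln (1 + k)) => u v.
by rewrite /k; field; apply/andP; split; apply/lt0r_neq0; lra.
Qed.

Lemma slack_excess_gt0 b k : 0 < b <= 1 / 2 -> 0 <= k <= 3 * (1 - b) / b ->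
  (b != 1 / 2) || (k != 1) -> 0 < slack k + k * heavy_excess b.
Proof.
move=> bP /andP[k0 kb]; have m0 := heavy_excess_ge0 bP.
have [k3|k3 _] := leP k 3.
  (* Up to 3 [slack] suffices, except at its zero 1, where the excess must be positive. *)
  have [->|k1 _] := eqVneq k 1; last first.
    by apply: ltr_pwDl; [apply: slack_gt0; rewrite ?k0|exact: mulr_ge0].
  rewrite orbF => bn2; rewrite slack1 add0r mul1r; apply: heavy_excess_gt0.
  by move: bP; rewrite le_eqVlt (negPf bn2).
have der (u : R) : 0 < u -> is_derive u 1 (fun t => slack t + t * heavy_excess b)
    (dslack u + heavy_excess b).
  move=> u0; have h := is_deriveD (is_derive_slack u0)
    (is_deriveZ (heavy_excess b) (is_derive_id u (1 : R))).
  apply: (is_derive_congr h) => [t|]; last by rewrite /GRing.scale/= mulr1.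
  by rewrite !fctE/= /GRing.scale/= [_ * t]mulrC.
have [b2 b3 _] := @ln2_ln3_ln5_bounds R.
apply: (concave_gt0 (a := 3) (b := 3 * (1 - b) / b)
  (f := fun t => slack t + t * heavy_excess b)
  (df := fun t => dslack t + heavy_excess b)).
- by move=> u ?; apply: der; lra.
- by move=> u v u3 uv _; rewrite lerD2r ltW// dslack_decr//; nra.
- by apply: ltr_pwDl; [exact: slack3_gt0|exact: mulr_ge0].
- by rewrite edge_slackE// edge_slack_gt0//; lra.
- by rewrite (ltW k3).
Qed.

Lemma heavy_gap_gt0 b x : 0 < b <= 1 / 2 -> 0 <= x <= 3 * (1 - b) ->
  (b != 1 / 2) || (x != 1 / 2) -> 0 < heavy_gap b x.
Proof.
move=> bP /andP[x0 x3] neq; have /andP[b0 _] := bP.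
rewrite heavy_gapE// mulr_gt0// slack_excess_gt0//.
  by rewrite divr_ge0 ?(ltW b0)//= ler_pM2r// invr_gt0.
have [b_half|//] := eqVneq b (1 / 2); move: neq; rewrite b_half eqxx/=.
by apply: contra => /eqP; lra.
Qed.

Lemma heavy_gap_ge0 b x : 0 < b <= 1 / 2 -> 0 <= x <= 3 * (1 - b) ->
  0 <= heavy_gap b x.
Proof.
move=> bP xP.
have [/(heavy_gap_gt0 bP xP)/ltW//|] := boolP ((b != 1 / 2) || (x != 1 / 2)).
rewrite negb_or !negbK => /andP[/eqP b_half /eqP x_half].
by rewrite heavy_gapE ?b_half ?heavy_excess_half ?x_half ?divff ?slack1//; lra.
Qed.

End Gaps.

(** * Summing the gaps, with the equality cases *)

Section Defect.
Context {R : realType}.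
Implicit Types (b : R) (x y : 'I_3 -> R).
Local Notation l2 := (ln 2 : R).
Local Notation l3 := (ln 3 : R).

(* For nu with nu (0, i) = x i / 3, nu (1, i) = y i / 3 and second-side mass b,
   this is 3 ln 3 KL(nu, pi) - 6 ln 6 KL(nu P, pi). *)
Definition defect b x y : R :=
  l3 * (3 * l2 + \sum_i x i * ln (x i) + \sum_i y i * ln (y i))
  - (l2 + l3) * (\sum_i (x i + b) * ln (x i + b)
                 + \sum_i (y i + (1 - b)) * ln (y i + (1 - b))).

Lemma defect_sym b x y : defect (1 - b) y x = defect b x y.
Proof.
by rewrite /defect (_ : 1 - (1 - b) = b); [congr (_ * _ - _ * _); ring|ring].
Qed.

Lemma le_sum_ord n (F : 'I_n -> R) i : (forall j, 0 <= F j) -> F i <= \sum_j F j.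
Proof. by move=> F0; rewrite (bigD1 i)//= lerDl sumr_ge0. Qed.

Lemma defect_gapsE b x y :
  \sum_i x i = 3 * (1 - b) -> \sum_i y i = 3 * b ->
  defect b x y = \sum_i heavy_gap b (x i) + \sum_i light_gap b (y i).
Proof.
(* Once the mass constraints are multiplied by the slopes, the identity is linear. *)
move=> hx hy; have hx' := congr1 ( *%R (heavy_slope b)) hx.
have hy' := congr1 ( *%R (l2 - l3 * ln b)) hy.
rewrite /defect /heavy_gap /light_gap; move: hx' hy'.
by rewrite !big_ord_recl !big_ord0; lra.
Qed.

Lemma defect_pointE x y : \sum_i x i = 3 -> (forall i, y i = 0) ->
  defect 0 x y = l2 * \sum_i x i * (l3 - ln (x i)).
Proof.
move=> hx hy; have y1 : \sum_i y i * ln (y i) = 0.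
  by rewrite big1// => i _; rewrite hy mul0r.
have y2 : \sum_i (y i + (1 - 0)) * ln (y i + (1 - 0)) = 0.
  by rewrite big1// => i _; rewrite hy add0r subr0 ln1 mulr0.
have x1 : \sum_i (x i + 0) * ln (x i + 0) = \sum_i x i * ln (x i).
  by apply: eq_bigr => i _; rewrite addr0.
rewrite /defect y1 y2 x1; under [in RHS]eq_bigr do rewrite mulrBr.
by rewrite sumrB -mulr_suml hx; ring.
Qed.

Lemma xln3_gt0 (t : R) : 0 < t < 3 -> 0 < t * (l3 - ln t).
Proof. by move=> /andP[t0 t3]; rewrite mulr_gt0// subr_gt0 ltr_ln// posrE. Qed.

Lemma defect_light b x y : 0 <= b <= 1 / 2 ->
  (forall i, 0 <= x i) -> (forall i, 0 <= y i) ->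
  \sum_i x i = 3 * (1 - b) -> \sum_i y i = 3 * b ->
  0 <= defect b x y /\
  (defect b x y = 0 ->
     (forall i, x i = 1 / 2 /\ y i = 1 / 2) \/ exists i, x i = 3).
Proof.
move=> /andP[b_ge0 b2] x0 y0 hx hy.
have xle i : 0 <= x i <= 3 * (1 - b) by rewrite x0 -hx le_sum_ord.
have yle i : 0 <= y i <= 3 * b by rewrite y0 -hy le_sum_ord.
move: b_ge0; rewrite le_eqVlt => /predU1P[b0|b0].
  rewrite -b0 in hx hy xle yle *; rewrite subr0 mulr1 in hx xle.
  have y_0 i : y i = 0 by have := yle i; lra.
  have l20 : 0 < l2 by rewrite ln_gt0//; lra.
  have t0 i : 0 <= x i * (l3 - ln (x i)).
    have [->|xn0] := eqVneq (x i) 0; first by rewrite mul0r.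
    have [->|xn3] := eqVneq (x i) 3; first by rewrite subrr mulr0.
    by rewrite ltW// xln3_gt0// !lt_neqAle eq_sym xn0 xn3 /=; exact: xle.
  rewrite defect_pointE//; split; first by rewrite mulr_ge0 ?(ltW l20)// sumr_ge0.
  (* Every [x i * (l3 - ln (x i))] vanishes, so each [x i] is 0 or 3, and not all are 0. *)
  move/eqP; rewrite mulf_eq0 gt_eqF//= => /eqP /psumr_eq0P s0; right.
  have [i xn0] : exists i, x i != 0.
    apply/existsP; apply: contraT; rewrite negb_exists => /forallP x_0.
    move: hx; rewrite big1 => [|i _]; first by lra.
    by apply/eqP; have := x_0 i; rewrite negbK.
  exists i; apply/eqP; apply: contraT => xn3.
  have := @xln3_gt0 (x i); rewrite s0// ltxx; apply.
  by rewrite !lt_neqAle eq_sym xn0 xn3 /=; exact: xle.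
have bP : 0 < b <= 1 / 2 by rewrite b0.
have h0 i := heavy_gap_ge0 bP (xle i); have g0 i := light_gap_ge0 bP (yle i).
rewrite (defect_gapsE hx hy); split; first by rewrite addr_ge0// sumr_ge0.
move/eqP; rewrite paddr_eq0 ?sumr_ge0// => /andP[/eqP/psumr_eq0P hs /eqP/psumr_eq0P gs].
left=> i; have [b_half x_half] : b = 1 / 2 /\ x i = 1 / 2.
  suff : ~~ ((b != 1 / 2) || (x i != 1 / 2)).
    by rewrite negb_or !negbK => /andP[/eqP ? /eqP ?].
  by apply/negP => /(heavy_gap_gt0 bP (xle i)); rewrite hs// ltxx.
split=> //; rewrite -b_half; apply/eqP; apply: contraT.
by move=> /(light_gap_gt0 bP (yle i)); rewrite gs// ltxx.
Qed.

Lemma defect_ge0 b x y : 0 <= b <= 1 ->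
  (forall i, 0 <= x i) -> (forall i, 0 <= y i) ->
  \sum_i x i = 3 * (1 - b) -> \sum_i y i = 3 * b ->
  0 <= defect b x y /\
  (defect b x y = 0 -> (forall i, x i = 1 / 2 /\ y i = 1 / 2) \/
     exists i, x i = 3 \/ y i = 3).
Proof.
move=> bP x0 y0 hx hy; have [b2|b2] := leP b (1 / 2).
  have [|d0 dE] := @defect_light b x y _ x0 y0 hx hy; first by lra.
  by split=> // /dE [?|[i ?]]; [left|right; exists i; left].
(* The second side is now the heavy one, so the roles are exchanged. *)
rewrite -defect_sym.
have [|||d0 dE] := @defect_light (1 - b) y x _ y0 x0; try lra.
split=> // /dE [h|[i ?]]; [left=> i|right; exists i; by right].
by have [] := h i.
Qed.

End Defect.

(** * Relative entropy to the uniform distribution *)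

Section KLUniform.
Context {R : realType} {T : finType}.
Implicit Types (nu : {ffun T -> R}) (P : T -> T -> R).

Definition relent nu : R := \sum_x nu x * ln (nu x * #|T|%:R).

Lemma KL_uniformE nu : (0 < #|T|)%N -> KL nu (uniform_dist T) = (relent nu)%:E.
Proof.
move=> T0; rewrite /KL /relent -sumEFin; apply: eq_bigr => x _.
rewrite /KL_term ffunE; case: eqVneq => [->|_]; first by rewrite mul0r.
by rewrite invr_eq0 pnatr_eq0 eqn0Ngt T0/= invrK.
Qed.

(** Gibbs' inequality: with N = [#|T|], ln u <= u - 1 at u = 1 / (N nu x) gives nu x ln (N nu x) >=
    nu x - 1 / N, strictly unless nu x = 1 / N, and the right sides sum to 0. *)
Lemma relent_gt0 nu : is_dist nu -> nu <> uniform_dist T -> 0 < relent nu.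
Proof.
move=> [nu0 nu1] neq.
have N0 : (0 : R) < #|T|%:R.
  rewrite ltr0n lt0n; apply/eqP => T0; move: nu1; rewrite big_pred0.
    by move/eqP; rewrite eq_sym oner_eq0.
  by move=> x; have := fintype0 x T0.
have gt x : nu x != #|T|%:R^-1 -> 0 < nu x * ln (nu x * #|T|%:R) - (nu x - #|T|%:R^-1).
  move=> nx; have [->|nx0] := eqVneq (nu x) 0.
    by rewrite mul0r sub0r sub0r opprK invr_gt0.
  have nx_gt0 : 0 < nu x by rewrite lt0r nx0 nu0.
  have xN : 0 < nu x * #|T|%:R by rewrite mulr_gt0.
  have := @ln_lt_subr1 R (nu x * #|T|%:R)^-1.
  rewrite invr_gt0 invr_eq1 lnV ?posrE// => /(_ xN).
  rewrite -(inj_eq (mulIf (invr_neq0 (lt0r_neq0 N0)))) mulfK ?lt0r_neq0// mul1r.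
  move=> /(_ nx) lt_ln; have := ltr_pM2l nx_gt0; move: lt_ln => /[swap] <-.
  by rewrite mulrBr mulr1 invfM mulrA divff// mul1r mulrN; lra.
have -> : relent nu = \sum_x (nu x * ln (nu x * #|T|%:R) - (nu x - #|T|%:R^-1)).
  rewrite !sumrB nu1 (_ : \sum_(x : T) #|T|%:R^-1 = 1) ?subrr ?subr0//.
  by rewrite sumr_const -[LHS]mulr_natr mulVf ?lt0r_neq0.
have ge x : 0 <= nu x * ln (nu x * #|T|%:R) - (nu x - #|T|%:R^-1).
  have [nx|/gt/ltW//] := eqVneq (nu x) #|T|%:R^-1.
  by rewrite nx mulVf ?lt0r_neq0// ln1 mulr0 !subrr.
rewrite lt0r sumr_ge0// andbT; apply/eqP => /psumr_eq0P s0; apply: neq.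
apply/ffunP => x; rewrite ffunE; apply/eqP; apply: contraT => /gt.
by rewrite s0// ltxx.
Qed.

Lemma push_point_mass P (x y : T) : push (point_mass x) P y = P x y.
Proof.
rewrite ffunE (bigD1 x)//= ffunE eqxx mul1r big1 ?addr0// => z zx.
by rewrite ffunE (negPf zx) mul0r.
Qed.

Lemma point_mass_dist (x : T) : is_dist (point_mass x : {ffun T -> R}).
Proof.
split=> [y|]; first by rewrite ffunE ler0n.
rewrite (bigD1 x)//= ffunE eqxx big1 ?addr0// => y yx.
by rewrite ffunE (negPf yx).
Qed.

Lemma relent_point_mass (x : T) : relent (point_mass x) = ln #|T|%:R :> R.
Proof.
rewrite /relent (bigD1 x)//= ffunE eqxx !mul1r big1 ?addr0// => y yx.
by rewrite ffunE (negPf yx) mul0r.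
Qed.

Lemma point_massP nu x : is_dist nu -> nu x = 1 -> nu = point_mass x.
Proof.
move=> [nu0]; rewrite (bigD1 x)//= => + nx; rewrite nx => s1.
have /psumr_eq0P s0 : \sum_(y | y != x) nu y = 0 by lra.
apply/ffunP => y; rewrite ffunE; have [->//|yx] := eqVneq y x.
by rewrite s0// => z _; exact: nu0.
Qed.

End KLUniform.

(** * The lazy walk on the complete bipartite graph *)

Section LazyWalk.
Context {R : realType}.
Local Notation l2 := (ln 2 : R).
Local Notation l3 := (ln 3 : R).

Lemma sum_Knn n (F : Knn_vertex n -> R) :
  \sum_v F v = \sum_i F (ord0, i) + \sum_i F (ord_max, i).
Proof.
rewrite (eq_bigr (fun v => F (v.1, v.2))); last by case.
rewrite -(pair_bigA _ (fun s i => F (s, i)))/= big_ord_recl big_ord1.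
by rewrite (_ : lift ord0 ord0 = ord_max)//; exact/val_inj.
Qed.

Lemma push_lazy_walk n (nu : {ffun Knn_vertex n -> R}) v :
  push nu (@lazy_walk R n) v =
  nu v / 2 + (\sum_(u | u.1 != v.1) nu u) / (2 * n%:R).
Proof.
rewrite ffunE (bigD1 v)//= {1}/lazy_walk eqxx; congr (_ + _).
rewrite mulr_suml (bigID (fun u : Knn_vertex n => u.1 != v.1))/=.
rewrite [X in _ + X]big1 ?addr0 => [|u /andP[uv]]; last first.
  by rewrite /lazy_walk /Knn_adj (negPf uv) => /negPf ->; rewrite mulr0.
apply: eq_big => u; first by case: eqVneq => [->|]; rewrite ?eqxx.
by move=> /andP[uv uv1]; rewrite /lazy_walk /Knn_adj (negPf uv) uv1.
Qed.

Lemma sum_other_side n (nu : {ffun Knn_vertex n -> R}) :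
  (\sum_(u | u.1 != ord0) nu u = \sum_j nu (ord_max, j)) /\
  (\sum_(u | u.1 != ord_max) nu u = \sum_j nu (ord0, j)).
Proof.
split; rewrite big_mkcond sum_Knn/=.
  by rewrite big1 ?add0r.
by rewrite [X in _ + X]big1 ?addr0.
Qed.

Let V := Knn_vertex 3.
Let P : V -> V -> R := @lazy_walk R 3.

Lemma card_K33 : #|V|%:R = 6 :> R.
Proof. by rewrite card_prod !card_ord. Qed.

Lemma relent_walk_defect (nu : {ffun V -> R}) (b := \sum_i nu (ord_max, i)) :
  is_dist nu -> 3 * l3 * relent nu - 6 * (l2 + l3) * relent (push nu P) =
  defect b (fun i => 3 * nu (ord0, i)) (fun i => 3 * nu (ord_max, i)).
Proof.
move=> [nu0 nu1].
have a1 : \sum_i nu (ord0, i) = 1 - b by move: nu1; rewrite sum_Knn -/b; lra.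
have term v : nu v * ln (nu v * 6) =
    3^-1 * (3 * nu v * ln (3 * nu v)) + l2 * nu v.
  have [->|nz] := eqVneq (nu v) 0; first by rewrite !(mul0r, mulr0) addr0.
  have n0 : 0 < nu v by rewrite lt0r nz nu0.
  rewrite (_ : nu v * 6 = 2 * (3 * nu v)); last by ring.
  by rewrite lnM ?posrE ?mulr_gt0//; field.
have relentE : relent nu = 3^-1 * (\sum_i 3 * nu (ord0, i) * ln (3 * nu (ord0, i))
    + \sum_i 3 * nu (ord_max, i) * ln (3 * nu (ord_max, i))) + l2.
  rewrite /relent card_K33; under eq_bigr do rewrite term.
  by rewrite big_split/= -!mulr_sumr nu1 mulr1 sum_Knn.
(* On the first side the density of [push nu P] is 6 (nu v / 2 + b / 6) = 3 nu v + b; on the second,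
   1 - b replaces b. *)
have pushE : relent (push nu P) = 6^-1 *
    (\sum_i (3 * nu (ord0, i) + b) * ln (3 * nu (ord0, i) + b)
     + \sum_i (3 * nu (ord_max, i) + (1 - b)) * ln (3 * nu (ord_max, i) + (1 - b))).
  rewrite /relent card_K33 sum_Knn mulrDr !mulr_sumr; congr (_ + _);
    apply: eq_bigr => i _; rewrite push_lazy_walk/=.
    rewrite (sum_other_side nu).1 -/b.
    by rewrite (_ : _ * 6 = 3 * nu (ord0, i) + b); [rewrite mulrA; congr (_ * _)|]; field.
  rewrite (sum_other_side nu).2 a1.
  by rewrite (_ : _ * 6 = 3 * nu (ord_max, i) + (1 - b)); [rewrite mulrA; congr (_ * _)|]; field.
by rewrite relentE pushE /defect; field.
Qed.

Lemma relent_walk_le (nu : {ffun V -> R}) : is_dist nu ->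
  2 * (l2 + l3) * relent (push nu P) <= l3 * relent nu /\
  (2 * (l2 + l3) * relent (push nu P) = l3 * relent nu ->
     nu = uniform_dist V \/ exists v, nu = point_mass v).
Proof.
move=> nuP; have [nu0 nu1] := nuP; have := relent_walk_defect nuP.
rewrite sum_Knn in nu1; set b := \sum_i nu (ord_max, i) in nu1 *.
have b0 : 0 <= b by rewrite sumr_ge0.
have a0 : 0 <= \sum_i nu (ord0, i) by rewrite sumr_ge0.
set x := fun i => 3 * nu (ord0, i); set y := fun i => 3 * nu (ord_max, i) => dE.
have [|||||d0 d_eq] := @defect_ge0 R b x y.
- by lra.
- by move=> i; rewrite mulr_ge0.
- by move=> i; rewrite mulr_ge0.
- by rewrite -mulr_sumr; lra.
- by rewrite -mulr_sumr.
(* [defect] is three times the difference of the two sides. *)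
split; first by lra.
move=> eq; have /d_eq[half|[i xy3]] : defect b x y = 0 by lra.
  left; apply/ffunP => -[s i]; rewrite ffunE card_prod !card_ord.
  have [] := half i; rewrite /x /y.
  have [->|->] : s = ord0 \/ s = ord_max.
    by case: s => [[|[|//]] ?]; [left|right]; exact/val_inj.
  - by move=> + _; lra.
  - by move=> _; lra.
right; case: xy3 => [x3|y3].
  by exists (ord0, i); apply: point_massP => //; rewrite /x in x3; lra.
by exists (ord_max, i); apply: point_massP => //; rewrite /y in y3; lra.
Qed.

(** The vertex [v] keeps mass 1/2 at density 3; its neighbours have density 1, hence logarithm 0. *)
Lemma relent_walk_point_mass (v : V) : relent (push (point_mass v) P) = l3 / 2.
Proof.
rewrite /relent (bigD1 v)//= big1 ?addr0 => [|u uv]; rewrite push_point_mass.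
  rewrite /P /lazy_walk eqxx card_K33 (_ : 2^-1 * 6 = 3); last by field.
  by rewrite mulrC.
rewrite /P /lazy_walk eq_sym (negPf uv); case: ifP => _; last by rewrite mul0r.
by rewrite card_K33 (_ : (2 * 3)^-1 * 6 = 1) ?ln1 ?mulr0//; field.
Qed.

End LazyWalk.

(** * From entropy inequalities to the contraction coefficient and its maximisers *)

Theorem proposition29 (R : realType) (n : nat) (hn : n = 3%N) :
  let V := Knn_vertex n in
  let pi : {ffun V -> R} := uniform_dist V in
  let P : V -> V -> R := @lazy_walk R n in
  let c : R := ln n%:R / (2 * ln (2 * n%:R)) in
  eta_KL pi P = c%:E /\
  (forall nu : {ffun V -> R}, is_dist nu -> nu <> pi ->
    ((KL (push nu P) pi / KL nu pi)%E = c%:E <-> exists x : V, nu = point_mass x)).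
Proof.
subst n; move=> V pi P c.
have V0 : (0 < #|V|)%N by rewrite card_prod !card_ord.
have l6 : ln (2 * 3) = ln 2 + ln 3 :> R by rewrite lnM ?posrE.
have l60 : 0 < ln 2 + ln 3 :> R by rewrite addr_gt0// ln_gt0//; lra.
have cE : c = ln 3 / (2 * (ln 2 + ln 3)) by rewrite /c l6.
have ratioE (nu : {ffun V -> R}) : 0 < relent nu ->
    (KL (push nu P) pi / KL nu pi)%E = (relent (push nu P) / relent nu)%:E.
  by move=> r0; rewrite !KL_uniformE// inver gt_eqF.
have ratio_le (nu : {ffun V -> R}) : is_dist nu -> 0 < relent nu ->
    relent (push nu P) / relent nu <= c.
  move=> nuP r0; have [le _] := relent_walk_le nuP.
  by rewrite cE ler_pdivrMr// mulrAC ler_pdivlMr; [rewrite mulrC|lra].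
have ratio_point v : relent (push (point_mass v) P) / relent (point_mass v) = c.
  rewrite relent_walk_point_mass relent_point_mass card_prod !card_ord.
  by rewrite cE natrM l6; field; rewrite gt_eqF.
have point_gt0 (v : V) : 0 < relent (point_mass v) :> R.
  by rewrite relent_point_mass card_prod !card_ord natrM l6.
split.
  rewrite /eta_KL uniform_Knn_invariant//; apply/eqP; rewrite eq_le.
  apply/andP; split.
    apply: ge_ereal_sup => _ [nu [nuP [nu_gt0 _]] <-].
    have r0 : 0 < relent nu by rewrite -lte_fin -KL_uniformE.
    by rewrite ratioE// lee_fin ratio_le.
  (* Any point mass attains the ratio [c]. *)
  apply: ereal_sup_ubound; exists (point_mass (ord0, ord0)).
    split; first exact: point_mass_dist.
    by rewrite KL_uniformE// ltry lte_fin point_gt0.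
  by rewrite ratioE// ratio_point.
move=> nu nuP nu_pi; have r0 := relent_gt0 nuP nu_pi.
rewrite ratioE//; split=> [[]|[v ->]]; last by rewrite ratio_point.
(* Ratio [c] is the equality case of [relent_walk_le], whose uniform alternative is excluded by
   [nu_pi]. *)
move=> /(canRL (divfK (lt0r_neq0 r0))) eq.
have [_ /(_ _)[||//]] := relent_walk_le nuP; last by move=> /nu_pi.
by rewrite -/P eq cE; field; rewrite gt_eqF.
Qed.
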